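(* Consider the open generalized Katz-Lebowitz-Spohn (KLS) model on $\Lambda_L=\{1,\dots,L\}$, $L\ge 4$, with generator $\mathcal L$ and with parameters $r,\ell,\kappa,\lambda,\epsilon$, $z,z_-,z_+\in\mathbb{R}^+=(0,\infty)$, $r_i^\pm,\ell_i^\pm,\alpha_i,\gamma_i,\beta_i,\delta_i$ ($i\in\{1,2\}$) as defined in the context. Let $y=\frac{1-\epsilon}{1+\epsilon}$, $q_\pm=z_\pm z^{-1}$, and let $f,c,d_i^\pm,a_i^\pm$ be the combinations defined in the context. Everywhere below, an equation containing $\pm$ stands for two equations, one with all upper and one with all lower signs. (1) Let $0<|\epsilon|<1$. For any $z\in\mathbb{R}^+$, the Ising measure $$\pi_L^\ast(\boldsymbol\eta)=\frac1{Z_L}\, y^{\sum_{k=1}^{L-1}\eta_k\eta_{k+1}}\; z^{\sum_{k=2}^{L-1}\eta_k}\; z_-^{\eta_1}\,z_+^{\eta_L},\qquad \boldsymbol\eta\in\{0,1\}^L$$ ($Z_L$ the normalization constant) is invariant for $\mathcal L$ if and only if all of the following conditions (A)-(C) hold: (A) $$d_1^\pm=\frac{(f\epsilon+c)(1+\epsilon)+q_\pm^{-1}(f\epsilon-c)(1-\epsilon)}{2\epsilon},\qquad d_2^\pm=\frac{(f\epsilon+c)+q_\pm^{-1}(f\epsilon-c)}{2\epsilon},$$ $$a_1^\pm=\frac{d_1^\pm}{1+z_\pm},\qquad a_2^\pm=a_1^\pm+(q_\pm-1)\frac{(f\epsilon+c)(1+\epsilon)}{2\epsilon z_\pm}.$$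 (B) $$0=2\epsilon a_2^-(z_-+y^{-1})-\big(q_-(f\epsilon+c)+(f\epsilon-c)\big)(1+\epsilon),$$ $$0=2\epsilon a_2^+(z_++y^{-1})-\big(q_+(f\epsilon+c)+(f\epsilon-c)\big)(1+\epsilon).$$ (C) $a_1^+z_+=a_1^-z_-$. (2) Let $\epsilon=0$ and $c\neq0$. For any $z\in\mathbb{R}^+$, the Bernoulli product measure $$\pi_L^\ast(\boldsymbol\eta)=\frac{z_-^{\eta_1}}{1+z_-}\left(\prod_{k=2}^{L-1}\frac{z^{\eta_k}}{1+z}\right)\frac{z_+^{\eta_L}}{1+z_+}$$ is invariant for $\mathcal L$ if and only if all of the following conditions hold: (A0) $d_1^\pm=f+\frac{c}{1+z}$, $\quad d_2^\pm=f-\frac{c}{1+z^{-1}}$, $\quad a_1^\pm=\frac{d_1^\pm}{1+z}$, $\quad a_2^\pm=a_1^\pm-\frac{c}{1+z}$. (B0) $z_-=z_+=z$. (C0) $a_1^+=a_1^-$. (3) Let $\epsilon=0$ and $c=0$. For any $z,z_-,z_+\in\mathbb{R}^+$, the Bernoulli product measure displayed in (2) is invariant for $\mathcal L$ if and only if $$d_1^\pm=f\,\frac{1+z_\pm^{-1}}{1+z^{-1}},\qquad d_2^\pm=f\,\frac{1+z_\pm^{-1}}{1+z^{-1}},\qquad a_1^\pm=f\,\frac{z_\pm^{-1}}{1+z^{-1}},\qquad a_2^\pm=f\,\frac{z^{-1}}{1+z^{-1}}$$ and $a_1^+z_+=a_1^-z_-$.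
   Context: Configurations are $\boldsymbol\eta=(\eta_1,\dots,\eta_L)\in\Omega_L=\{0,1\}^L$; $\bar\eta_k:=1-\eta_k$. $\boldsymbol\eta^{k}$ is $\boldsymbol\eta$ with $\eta_k$ replaced by $1-\eta_k$; $\boldsymbol\eta^{k,k+1}$ is $\boldsymbol\eta$ with the values at sites $k$ and $k+1$ interchanged. Parameters: $r,\ell\ge 0$, $\kappa,\lambda,\epsilon\in(-1,1)$, $z,z_-,z_+>0$, and constants $r_i^\pm,\ell_i^\pm,\alpha_i,\gamma_i,\beta_i,\delta_i\ge0$ for $i=1,2$. The generator of the open generalized KLS model is, for $g:\Omega_L\to\mathbb{R}$, $$\mathcal L g(\boldsymbol\eta)=\sum_{k=1}^{L-1}w_k(\boldsymbol\eta)\,[g(\boldsymbol\eta^{k,k+1})-g(\boldsymbol\eta)]+(\alpha(\boldsymbol\eta)+\gamma(\boldsymbol\eta))\,[g(\boldsymbol\eta^{1})-g(\boldsymbol\eta)]+(\beta(\boldsymbol\eta)+\delta(\boldsymbol\eta))\,[g(\boldsymbol\eta^{L})-g(\boldsymbol\eta)].$$ Bulk bonds, $2\le k\le L-2$: $w_k=r_k+\ell_{k+1}$ with $$r_k(\boldsymbol\eta)=r\,\eta_k\bar\eta_{k+1}\big[(1+\kappa)(\bar\eta_{k-1}-\eta_{k+2})+(1+\epsilon)\eta_{k-1}+(1-\epsilon)\eta_{k+2}\big],$$ $$\ell_{k+1}(\boldsymbol\eta)=\ell\,\bar\eta_k\eta_{k+1}\big[(1+\lambda)(\bar\eta_{k-1}-\eta_{k+2})+(1-\epsilon)\eta_{k-1}+(1+\epsilon)\eta_{k+2}\big].$$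 Boundary bonds: $w_1=r^-+\ell^-$, $w_{L-1}=r^++\ell^+$ with $$r^-(\boldsymbol\eta)=\eta_1\bar\eta_2[r_1^-\bar\eta_3+r_2^-(1-\epsilon)\eta_3],\qquad \ell^-(\boldsymbol\eta)=z_-z^{-1}\,\bar\eta_1\eta_2[\ell_1^-\bar\eta_3+\ell_2^-(1+\epsilon)\eta_3],$$ $$r^+(\boldsymbol\eta)=z_+z^{-1}\,\eta_{L-1}\bar\eta_L[r_1^+\bar\eta_{L-2}+r_2^+(1+\epsilon)\eta_{L-2}],\qquad \ell^+(\boldsymbol\eta)=\bar\eta_{L-1}\eta_L[\ell_1^+\bar\eta_{L-2}+\ell_2^+(1-\epsilon)\eta_{L-2}].$$ Insertion and removal of particles at the boundary sites: $$\alpha(\boldsymbol\eta)=z_-\bar\eta_1(\alpha_1\bar\eta_2+\alpha_2\eta_2),\qquad \gamma(\boldsymbol\eta)=\eta_1(\gamma_1\bar\eta_2+\gamma_2\eta_2),$$ $$\beta(\boldsymbol\eta)=\eta_L(\beta_1\bar\eta_{L-1}+\beta_2\eta_{L-1}),\qquad \delta(\boldsymbol\eta)=z_+\bar\eta_L(\delta_1\bar\eta_{L-1}+\delta_2\eta_{L-1}).$$ Parameter combinations: $y=\frac{1-\epsilon}{1+\epsilon}$, $q_\pm=z_\pm/z$, $f=r-\ell$, $c=r\kappa-\ell\lambda$, $d_i^\pm=r_i^\pm-\ell_i^\pm$ ($i=1,2$), $$a_1^-=\alpha_1-\gamma_1,\quad a_2^-=\alpha_2-\gamma_2y,\quad a_1^+=\beta_1-\delta_1,\quad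 a_2^+=\beta_2y-\delta_2.$$ A probability measure $\pi$ on $\Omega_L$ is invariant if $\sum_{\boldsymbol\eta}\pi(\boldsymbol\eta)\,\mathcal L g(\boldsymbol\eta)=0$ for all $g:\Omega_L\to\mathbb{R}$. *)

(* Defs.v *)
From mathcomp Require Import all_boot all_order all_algebra.
From mathcomp Require Import reals.

Set Implicit Arguments.
Unset Strict Implicit.
Unset Printing Implicit Defensive.

Import Order.TTheory GRing.Theory Num.Theory.
Local Open Scope ring_scope.

(* Minus is the left end (site 1), Plus the right end (site L). *)
Inductive side := Minus | Plus.

(* Sites are numbered 1, ..., L, whereas tuples are indexed from 0. *)
Definition config (L : nat) : Type := L.-tuple bool.

Definition site (L : nat) (eta : config L) (k : nat) : bool :=
  nth false eta k.-1.

Definition flip (L : nat) (eta : config L) (k : nat) : config L :=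
  [tuple (if i.+1 == k then ~~ site eta i.+1 else site eta i.+1) | i < L].

Definition exchange (L : nat) (eta : config L) (k : nat) : config L :=
  [tuple (if i.+1 == k then site eta k.+1
          else if i.+1 == k.+1 then site eta k
          else site eta i.+1) | i < L].

Section KLS.
Variable R : realType.

(* For s : side, zb is z_-, z_+; rb1, rb2, lb1, lb2 are r_i^-, r_i^+ and
   l_i^-, l_i^+ for i = 1, 2. *)
Record kls_params := KLSParams {
  hop_r : R; hop_l : R;
  kappa : R; lambda : R; eps : R;
  z : R; zb : side -> R;
  rb1 : side -> R; rb2 : side -> R;
  lb1 : side -> R; lb2 : side -> R;
  alpha1 : R; alpha2 : R; gamma1 : R; gamma2 : R;
  beta1 : R; beta2 : R; delta1 : R; delta2 : R
}.

Record admissible (p : kls_params) : Prop := Admissible {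
  hop_r_ge0 : 0 <= hop_r p;
  hop_l_ge0 : 0 <= hop_l p;
  kappa_bound : -1 < kappa p < 1;
  lambda_bound : -1 < lambda p < 1;
  eps_bound : -1 < eps p < 1;
  z_gt0 : 0 < z p;
  zb_gt0 : forall s, 0 < zb p s;
  rb1_ge0 : forall s, 0 <= rb1 p s;
  rb2_ge0 : forall s, 0 <= rb2 p s;
  lb1_ge0 : forall s, 0 <= lb1 p s;
  lb2_ge0 : forall s, 0 <= lb2 p s;
  alpha1_ge0 : 0 <= alpha1 p;
  alpha2_ge0 : 0 <= alpha2 p;
  gamma1_ge0 : 0 <= gamma1 p;
  gamma2_ge0 : 0 <= gamma2 p;
  beta1_ge0 : 0 <= beta1 p;
  beta2_ge0 : 0 <= beta2 p;
  delta1_ge0 : 0 <= delta1 p;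
  delta2_ge0 : 0 <= delta2 p
}.

Definition y (p : kls_params) : R := (1 - eps p) / (1 + eps p).
Definition q (p : kls_params) (s : side) : R := zb p s / z p.
Definition f (p : kls_params) : R := hop_r p - hop_l p.
Definition c (p : kls_params) : R := hop_r p * kappa p - hop_l p * lambda p.
Definition d1 (p : kls_params) (s : side) : R := rb1 p s - lb1 p s.
Definition d2 (p : kls_params) (s : side) : R := rb2 p s - lb2 p s.
Definition a1 (p : kls_params) (s : side) : R :=
  match s with
  | Minus => alpha1 p - gamma1 p
  | Plus => beta1 p - delta1 p
  end.
Definition a2 (p : kls_params) (s : side) : R :=
  match s with
  | Minus => alpha2 p - gamma2 p * y p
  | Plus => beta2 p * y p - delta2 p
  end.

Section Dynamics.
Variables (p : kls_params) (L : nat).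
Implicit Types (eta : config L) (k : nat).

Definition occ eta k : R := (site eta k : nat)%:R.
Definition hole eta k : R := 1 - occ eta k.

Definition bulk_right eta k : R :=
  hop_r p * occ eta k * hole eta k.+1 *
  ((1 + kappa p) * (hole eta k.-1 - occ eta k.+2)
   + (1 + eps p) * occ eta k.-1 + (1 - eps p) * occ eta k.+2).

(* The leftward jump across the bond (k, k+1), i.e. l_{k+1}. *)
Definition bulk_left eta k : R :=
  hop_l p * hole eta k * occ eta k.+1 *
  ((1 + lambda p) * (hole eta k.-1 - occ eta k.+2)
   + (1 - eps p) * occ eta k.-1 + (1 + eps p) * occ eta k.+2).

Definition first_right eta : R :=
  occ eta 1 * hole eta 2 *
  (rb1 p Minus * hole eta 3 + rb2 p Minus * (1 - eps p) * occ eta 3).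
Definition first_left eta : R :=
  zb p Minus / z p * (hole eta 1 * occ eta 2) *
  (lb1 p Minus * hole eta 3 + lb2 p Minus * (1 + eps p) * occ eta 3).
Definition last_right eta : R :=
  zb p Plus / z p * (occ eta (L - 1) * hole eta L) *
  (rb1 p Plus * hole eta (L - 2)
   + rb2 p Plus * (1 + eps p) * occ eta (L - 2)).
Definition last_left eta : R :=
  hole eta (L - 1) * occ eta L *
  (lb1 p Plus * hole eta (L - 2)
   + lb2 p Plus * (1 - eps p) * occ eta (L - 2)).

Definition bond_rate eta k : R :=
  if k == 1 then first_right eta + first_left eta
  else if k == (L - 1)%N then last_right eta + last_left eta
  else bulk_right eta k + bulk_left eta k.

Definition alpha_rate eta : R :=
  zb p Minus * hole eta 1 * (alpha1 p * hole eta 2 + alpha2 p * occ eta 2).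
Definition gamma_rate eta : R :=
  occ eta 1 * (gamma1 p * hole eta 2 + gamma2 p * occ eta 2).
Definition beta_rate eta : R :=
  occ eta L * (beta1 p * hole eta (L - 1) + beta2 p * occ eta (L - 1)).
Definition delta_rate eta : R :=
  zb p Plus * hole eta L *
  (delta1 p * hole eta (L - 1) + delta2 p * occ eta (L - 1)).

Definition generator (g : config L -> R) eta : R :=
  \sum_(1 <= k < L) bond_rate eta k * (g (exchange eta k) - g eta)
  + (alpha_rate eta + gamma_rate eta) * (g (flip eta 1) - g eta)
  + (beta_rate eta + delta_rate eta) * (g (flip eta L) - g eta).

Definition is_probability (mu : config L -> R) : Prop :=
  (forall eta, 0 <= mu eta) /\ \sum_eta mu eta = 1.

Definition invariant_measure (mu : config L -> R) : Prop :=
  is_probability mu /\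
  forall g : config L -> R, \sum_eta mu eta * generator g eta = 0.

Definition ising_weight eta : R :=
  y p ^+ (\sum_(1 <= k < L) site eta k * site eta k.+1)%N
  * z p ^+ (\sum_(2 <= k < L) site eta k)%N
  * zb p Minus ^+ site eta 1 * zb p Plus ^+ site eta L.

Definition ising_measure eta : R :=
  ising_weight eta / \sum_(xi : config L) ising_weight xi.

Definition bernoulli_measure eta : R :=
  zb p Minus ^+ site eta 1 / (1 + zb p Minus)
  * (\prod_(2 <= k < L) (z p ^+ site eta k / (1 + z p)))
  * (zb p Plus ^+ site eta L / (1 + zb p Plus)).

End Dynamics.
End KLS.

(* Main.v *)
Require Import Defs.
From mathcomp Require Import all_boot all_order all_algebra.
From mathcomp Require Import reals.
From mathcomp Require Import ring lra zify.

Set Implicit Arguments.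
Unset Strict Implicit.
Unset Printing Implicit Defensive.

Import Order.TTheory GRing.Theory Num.Theory.
Local Open Scope ring_scope.

(** Invariance of [mu] means that the net probability flux into every
    configuration vanishes. For the Ising weight [W] the flux caused by the bond
    (k, k+1) in the bulk, divided by [W eta], depends on the four sites
    k-1, ..., k+2 only, and it is a discrete gradient: it equals
    [bulk_current] at (k, k+1, k+2) minus [bulk_current] at (k-1, k, k+1). This
    is where the form of the KLS rates enters. Summing over the bulk bonds
    leaves two end terms, which combine with the boundary bonds and the
    reservoirs to give ([net_flux_ising])

      net flux = W eta * (D_-(eta_1, eta_2, eta_3)
                          - D_+(eta_L, eta_(L-1), eta_(L-2))),

    where D_- and D_+ are one function [edge_defect] of the parameters of the
    respective end; the right end is the mirror image of the left one with the
    sign reversed.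

    So invariance says that D_- and D_+ agree on all configurations. For L >= 6
    the two triples are disjoint, hence both defects are the same constant. For
    L = 4 and L = 5 the triples share sites, but D(0,0,.) and D(1,1,.) never
    depend on the third argument, and this still forces the defects to be
    constant ([overlapping_ends]).

    Constancy of one defect is a system of five equations
    ([edge_equations]), linear in d_1, d_2, a_1, a_2, and equality of the two
    constants is a_1^+ z_+ = a_1^- z_-. Solving the linear system gives the
    formulas of the theorem; the case distinction arises because the equations
    for d_2 read (1 - eps) d_2 = d_1 - (f eps + c) and
    (1 + eps) d_2 = d_1 + (f eps - c) / q, which determine d_1 and d_2 when
    eps <> 0 but at eps = 0 degenerate to c = c / q, that is to q = 1 or c = 0.
    At eps = 0 one has y = 1, and the product measure is the normalized Ising
    weight. *)

(** * Configurations, flips and exchanges *)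

Section Configurations.
Variable L : nat.
Implicit Types (eta xi : config L) (j k : nat).

Lemma site_tuple (F : nat -> bool) j : (1 <= j <= L)%N ->
  site ([tuple F (nat_of_ord i).+1 | i < L] : config L) j = F j.
Proof.
case/andP=> j1 jL; rewrite /site.
have hj : (j.-1 < L)%N by lia.
rewrite -[j.-1]/(nat_of_ord (Ordinal hj)) nth_mktuple /=.
by rewrite prednK.
Qed.

Lemma site_over eta j : (L < j)%N -> site eta j = false.
Proof. by move=> jL; rewrite /site nth_default // size_tuple; lia. Qed.

Lemma config_eq eta xi :
  (forall j, (1 <= j <= L)%N -> site eta j = site xi j) -> eta = xi.
Proof.
move=> h; apply: eq_from_tnth => i.
by rewrite !(tnth_nth false); apply: (h i.+1); rewrite ltn_ord.
Qed.

Lemma site_flip eta k j : (1 <= j)%N -> (1 <= k <= L)%N ->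
  site (flip eta k) j = if j == k then ~~ site eta j else site eta j.
Proof.
move=> j1 hk; case: (leqP j L) => jL.
  by rewrite (site_tuple (fun i => if i == k then ~~ site eta i else site eta i))
     ?j1.
by rewrite !site_over //; case: eqP => // ?; lia.
Qed.

Lemma site_exchange eta k j : (1 <= j)%N -> (1 <= k < L)%N ->
  site (exchange eta k) j =
  if j == k then site eta k.+1 else if j == k.+1 then site eta k
  else site eta j.
Proof.
move=> j1 hk; case: (leqP j L) => jL.
  by rewrite (site_tuple (fun i => if i == k then site eta k.+1
    else if i == k.+1 then site eta k else site eta i)) ?j1.
by rewrite !(@site_over _ j) //; case: eqP => [|_]; [lia|case: eqP => //; lia].
Qed.

Lemma flipK k : (1 <= k <= L)%N -> involutive (fun eta => flip eta k).
Proof.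
move=> hk eta; apply: config_eq => j /andP[j1 _].
by rewrite !site_flip //; case: eqP => // _; rewrite negbK.
Qed.

Lemma exchangeK k : (1 <= k < L)%N -> involutive (fun eta => exchange eta k).
Proof.
move=> hk eta; apply: config_eq => j /andP[j1 jL].
rewrite !site_exchange // ?eqxx; try lia.
have -> : (k.+1 == k) = false by lia.
by case: eqP => [->|_] //; case: eqP => [->|_].
Qed.

Lemma exchange_id eta k : (1 <= k < L)%N -> site eta k = site eta k.+1 ->
  exchange eta k = eta.
Proof.
move=> hk h; apply: config_eq => j /andP[j1 jL].
by rewrite site_exchange //; case: eqP => [->|_] //; case: eqP => [->|_].
Qed.

Lemma exchange_flip eta k : (1 <= k < L)%N ->
  site eta k = ~~ site eta k.+1 -> exchange eta k = flip (flip eta k) k.+1.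
Proof.
move=> hk h; apply: config_eq => j /andP[j1 jL].
rewrite site_exchange // !site_flip //; try lia.
case: (eqVneq j k) => [->|jk]; first by rewrite ifN ?h ?negbK //; lia.
by case: eqP => [->|//].
Qed.

End Configurations.

(** * Functions of the two ends that agree on all configurations *)

(** For L = 4 and L = 5 the two triples of sites overlap. Site 1 is never in the
    right triple, so [g] is constant in its first argument, and the insensitivity
    of [g b b _] to the third argument extends to every [g _ b _]. Reading
    [g false false true] and [g true true true] as values [h true true _], which
    agree, identifies the two values that remain. *)
Lemma overlapping_ends (L : nat) (T : Type) (g h : bool -> bool -> bool -> T) :
  (4 <= L)%N ->
  g false false false = g false false true ->
  g true true false = g true true true ->
  h false false false = h false false true ->
  h true true false = h true true true ->
  (forall eta : config L, g (site eta 1) (site eta 2) (site eta 3) =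
     h (site eta L) (site eta (L - 1)) (site eta (L - 2))) ->
  forall b1 b2 b3,
    g b1 b2 b3 = g false false false /\ h b1 b2 b3 = g false false false.
Proof.
move=> hL g0 g1 h0 h1 H.
have left_end b1 b2 b3 b4 :
    g b1 b2 b3 = h b4 b3 (if L == 4%N then b2 else b3).
  (* One family of configurations for all L: for L = 4 the site L - 2 is the
     second one, otherwise it carries the value of the third one. *)
  pose fill j := if j == 1 then b1 else if j == 2 then b2
     else if j == L then b4 else b3.
  have := H [tuple fill (nat_of_ord i).+1 | i < L].
  rewrite !site_tuple; try lia.
  rewrite /fill /=.
  have -> : (L - 1 == 1)%N = false by lia.
  have -> : (L - 1 == 2)%N = false by lia.
  have -> : (L - 1 == L)%N = false by lia.
  have -> : (L == 1)%N = false by lia.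
  have -> : (L == 2)%N = false by lia.
  have -> : (3 == L)%N = false by lia.
  have -> : (L - 2 == 1)%N = false by lia.
  have -> : (L - 2 == L)%N = false by lia.
  have -> : (L - 2 == 2)%N = (L == 4)%N by lia.
  by rewrite eqxx.
have gfree b1 b2 b3 : g b1 b2 b3 = g b2 b2 b2.
  transitivity (g b2 b2 b3); first by rewrite !(left_end _ _ _ false).
  by case: b2 b3 => -[].
have gconst b1 b2 b3 : g b1 b2 b3 = g false false false.
  rewrite gfree; case: b2 => //.
  rewrite -(gfree false true true) -(gfree false false true).
  by rewrite !(left_end _ _ _ true); case: ifP => _; rewrite ?h1.
move=> b1 b2 b3; split=> //.
pose fill j := if j == L then b1 else if j == (L - 1)%N then b2 else b3.
have := H [tuple fill (nat_of_ord i).+1 | i < L].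
rewrite gconst !site_tuple; try lia.
rewrite /fill.
have -> : (L - 1 == L)%N = false by lia.
have -> : (L - 2 == L)%N = false by lia.
have -> : (L - 2 == L - 1)%N = false by lia.
by rewrite !eqxx => ->.
Qed.

(** * The linear equations at one end *)

Section EdgeAlgebra.
Variable F : realFieldType.
Implicit Types e f c z q Z : F.

(** The defect of an end equals [- (Z * a1)] on the triples 000 and 001. These
    equations say that it has the same value on 100, 101, 010, 011 and on both
    110 and 111; the first has been used to simplify the second. *)
Definition edge_equations e f c q Z (d1 d2 a1 a2 : F) : Prop :=
  [/\ d1 = (1 + Z) * a1,
      d2 * (1 - e) = d1 - (f * e + c),
      q * d1 - Z * a2 - (f + c) = - (Z * a1),
      q * (d2 * (1 + e)) - Z * a2 - f * (1 + e) = - (Z * a1)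
    & a2 / ((1 - e) / (1 + e)) - f * (1 + e) = - (Z * a1)].

(** Proves an equation by exhibiting the difference of its sides as a
    combination of known equations. *)
Lemma eq_of_sub (a b t : F) : a - b = t -> t = 0 -> a = b.
Proof. by move=> h t0; apply/eqP; rewrite -subr_eq0 h t0. Qed.

(** The second equation determines [d1 - d2 * (1 - e)], and the difference of
    the third and fourth determines [d1 - d2 * (1 + e)]; for [e != 0] these two
    give [d1] and [d2]. The first equation then gives [a1], the third [a2], and
    the last one is the compatibility relation involving [Z]. *)
Lemma edge_equations_ising e f c q Z (d1 d2 a1 a2 : F) :
  e != 0 -> 1 + e != 0 -> 1 - e != 0 -> q != 0 -> 0 < Z ->
  edge_equations e f c q Z d1 d2 a1 a2 <->
  [/\ d1 = ((f * e + c) * (1 + e) + q^-1 * (f * e - c) * (1 - e)) / (2 * e),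
      d2 = ((f * e + c) + q^-1 * (f * e - c)) / (2 * e),
      a1 = d1 / (1 + Z)
    & a2 = a1 + (q - 1) * ((f * e + c) * (1 + e) / (2 * e * Z))] /\
  0 = 2 * e * a2 * (Z + ((1 - e) / (1 + e))^-1)
      - (q * (f * e + c) + (f * e - c)) * (1 + e).
Proof.
move=> e0 ep en q0 Zp.
have Z0 : Z != 0 by lra.
have Z1 : 1 + Z != 0 by lra.
split=> [[E1 E2 E3 E4 E5]|[[-> -> -> ->] B]].
  have H2 : d2 = ((f * e + c) + q^-1 * (f * e - c)) / (2 * e).
    apply: (@eq_of_sub _ _ (- (q * (d2 * (1 - e) - (d1 - (f * e + c)))
      + (q * d1 - Z * a2 - (f + c) - - (Z * a1))
      - (q * (d2 * (1 + e)) - Z * a2 - f * (1 + e) - - (Z * a1)))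
       / (2 * e * q))).
      by field; rewrite e0 q0.
    by rewrite E2 E3 E4; field; rewrite e0 q0.
  have H1 : d1 = ((f * e + c) * (1 + e) + q^-1 * (f * e - c) * (1 - e))
                  / (2 * e).
    transitivity (d2 * (1 - e) + (f * e + c)); first by rewrite E2; ring.
    by rewrite H2; field; rewrite e0 q0.
  have H3 : a1 = d1 / (1 + Z) by rewrite E1; field.
  have H4 : a2 = a1 + (q - 1) * ((f * e + c) * (1 + e) / (2 * e * Z)).
    transitivity (a1 + (q * d1 - (f + c)) / Z).
      apply: (@eq_of_sub _ _
        (- (q * d1 - Z * a2 - (f + c) - - (Z * a1)) / Z)); first by field.
      by rewrite E3 subrr oppr0 mul0r.
    by rewrite H1; field; rewrite e0 Z0 q0.
  split; first by split.
  apply/esym/(@eq_of_sub _ _ (2 * e * (a2 / ((1 - e) / (1 + e))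
     - f * (1 + e) - - (Z * a1)) + 2 * e * Z *
     (a2 - (a1 + (q - 1) * ((f * e + c) * (1 + e) / (2 * e * Z)))))).
    by field; rewrite e0 Z0 ep en.
  by rewrite E5 {1}H4 !subrr !mulr0 addr0.
split; try by field; rewrite ?e0 ?Z0 ?q0 ?Z1.
move: B; set a2' := (X in 2 * e * X * _) => B.
apply: (@eq_of_sub _ _ ((2 * e * a2' * (Z + ((1 - e) / (1 + e))^-1)
      - (q * (f * e + c) + (f * e - c)) * (1 + e)) / (2 * e))).
  by rewrite /a2'; field; rewrite ?e0 ?Z0 ?q0 ?Z1 ?ep ?en.
by rewrite -B mul0r.
Qed.

(** At [e = 0] the second equation reads [d1 - d2 = c], and the difference of
    the third and fourth reads [Z / z * (d1 - d2) = c], whence [Z = z]. *)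
Lemma edge_equations_bernoulli_neq0 f c z Z (d1 d2 a1 a2 : F) :
  c != 0 -> 0 < z -> 0 < Z ->
  edge_equations 0 f c (Z / z) Z d1 d2 a1 a2 <->
  [/\ d1 = f + c / (1 + z), d2 = f - c / (1 + z^-1),
      a1 = d1 / (1 + z) & a2 = a1 - c / (1 + z)] /\ Z = z.
Proof.
move=> c0 zp Zp.
have z0 : z != 0 by lra.
have z1 : 1 + z != 0 by lra.
split=> [[E1 E2 E3 E4 E5]|[[-> -> -> ->] ->]]; last first.
  by split; field; rewrite ?z0 ?z1.
have Zz : Z = z.
  apply: (mulfI c0).
  transitivity (z * (Z / z * d1 - Z / z * (d2 * (1 + 0)))).
    rewrite (_ : d1 = d2 * (1 - 0) + (f * 0 + c)); first by field.
    by rewrite E2; ring.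
  rewrite (_ : _ - _ = (Z / z * d1 - Z * a2 - (f + c))
    - (Z / z * (d2 * (1 + 0)) - Z * a2 - f * (1 + 0)) + c); last by ring.
  by rewrite E3 E4; ring.
subst Z; rewrite divff // mul1r in E3.
have H1 : d1 = f + c / (1 + z).
  apply: (@eq_of_sub _ _ (((d1 - z * a2 - (f + c) - - (z * a1))
    + z * (a2 / ((1 - 0) / (1 + 0)) - f * (1 + 0) - - (z * a1))
    + z * (d1 - (1 + z) * a1)) / (1 + z))); first by field.
  by rewrite E3 E5 E1 !subrr !mulr0 !addr0 mul0r.
have H3 : a1 = d1 / (1 + z) by rewrite E1; field.
split=> //; split=> //.
  transitivity (d2 * (1 - 0)); first by ring.
  by rewrite E2 H1; field; rewrite z0 addrC.
transitivity (a2 / ((1 - 0) / (1 + 0)) - f * (1 + 0) + f); first by field.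
by rewrite E5 H3 H1; field.
Qed.

(** With [c = 0] the second and fourth equations both say [d1 = d2], given the
    third, so that [Z] stays free. *)
Lemma edge_equations_bernoulli_eq0 f z Z (d1 d2 a1 a2 : F) :
  0 < z -> 0 < Z ->
  edge_equations 0 f 0 (Z / z) Z d1 d2 a1 a2 <->
  [/\ d1 = f * ((1 + Z^-1) / (1 + z^-1)), d2 = f * ((1 + Z^-1) / (1 + z^-1)),
      a1 = f * (Z^-1 / (1 + z^-1)) & a2 = f * (z^-1 / (1 + z^-1))].
Proof.
move=> zp Zp.
have z0 : z != 0 by lra.
have z1 : 1 + z != 0 by lra.
have z1' : z + 1 != 0 by lra.
have Z0 : Z != 0 by lra.
have Z1 : 1 + Z != 0 by lra.
split=> [[E1 E2 E3 E4 E5]|[-> -> -> ->]]; last first.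
  by split; field; rewrite ?z0 ?z1 ?z1' ?Z0.
have H3 : a1 = f * (Z^-1 / (1 + z^-1)).
  apply: (@eq_of_sub _ _ (((Z / z * d1 - Z * a2 - (f + 0) - - (Z * a1))
    + Z * (a2 / ((1 - 0) / (1 + 0)) - f * (1 + 0) - - (Z * a1))
    - Z / z * (d1 - (1 + Z) * a1)) / ((1 + Z) * (Z / z + Z)))).
    by field; rewrite ?z0 ?z1 ?z1' ?Z0 ?Z1 /=; nra.
  by rewrite E3 E5 E1 !subrr !mulr0 subr0 addr0 mul0r.
have H1 : d1 = f * ((1 + Z^-1) / (1 + z^-1)).
  by rewrite E1 H3; field; rewrite ?z0 ?z1 ?z1' ?Z0.
split=> //.
  transitivity (d2 * (1 - 0)); first by ring.
  by rewrite E2 -H1; ring.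
transitivity (a2 / ((1 - 0) / (1 + 0)) - f * (1 + 0) + f); first by field.
by rewrite E5 H3; field; rewrite ?z0 ?z1 ?z1' ?Z0.
Qed.

End EdgeAlgebra.

(** * The Ising weight under flips and exchanges *)

Section Balance.
Variables (R : realType) (p : kls_params R) (L : nat).
Hypotheses (hL : (4 <= L)%N) (hp : admissible p).
Implicit Types (eta xi : config L) (j k : nat) (b : bool).

Local Notation W := (@ising_weight R p L).

Let onep_eps_gt0 : 0 < 1 + eps p.
Proof. by case: hp => _ _ _ _ + *; lra. Qed.
Let onem_eps_gt0 : 0 < 1 - eps p.
Proof. by case: hp => _ _ _ _ + *; lra. Qed.

Lemma y_gt0 : 0 < y p. Proof. exact: divr_gt0. Qed.

Lemma ising_weight_gt0 eta : 0 < W eta.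
Proof.
by rewrite !mulr_gt0 ?exprn_gt0 ?y_gt0 ?zb_gt0 ?z_gt0.
Qed.

Definition fugacity k : R :=
  if k == 1 then zb p Minus else if k == L then zb p Plus else z p.

Lemma fugacity_gt0 k : 0 < fugacity k.
Proof.
by rewrite /fugacity; case: ifP => _; [|case: ifP => _];
  rewrite ?zb_gt0 ?z_gt0.
Qed.

(** The guard is essential: [site eta 0] is [site eta 1] because of the truncated
   predecessor, whereas there is no particle to the left of site 1. To the right
   of site L the default value of [nth] gives an empty site. *)
Definition left_nbr eta k : bool := (1 < k)%N && site eta k.-1.

Lemma ising_weight_flip eta k : (1 <= k <= L)%N -> site eta k = false ->
  W (flip eta k) =
  W eta * (fugacity k * y p ^+ left_nbr eta k * y p ^+ site eta k.+1).
Proof.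
move=> hk ek0.
have E : (\sum_(1 <= j < L) site (flip eta k) j * site (flip eta k) j.+1 =
   \sum_(1 <= j < L) site eta j * site eta j.+1
   + site eta k.+1 + left_nbr eta k)%N.
  have -> : nat_of_bool (site eta k.+1) =
     (\sum_(1 <= j < L | j == k) site eta j.+1)%N.
    rewrite big_nat1_eq; case: ifP => // hk1.
    by rewrite site_over //; lia.
  have -> : nat_of_bool (left_nbr eta k) =
     (\sum_(1 <= j < L | j == k.-1) site eta j)%N.
    rewrite big_nat1_eq /left_nbr.
    have -> : (1 < k)%N = (0 < k.-1 < L)%N by lia.
    by case: ifP.
  rewrite [X in (_ + X + _)%N]big_mkcond [X in (_ + _ + X)%N]big_mkcond.
  rewrite -!big_split /=.
  apply: eq_big_nat => j hj; rewrite !site_flip //; try lia.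
  case: (eqVneq j k) => [->|jk].
    have -> : (k.+1 == k) = false by lia.
    have -> : (k == k.-1) = false by lia.
    by rewrite ek0 mul1n mul0n addn0.
  have -> : (j == k.-1) = (j.+1 == k) by lia.
  case: eqP => [->|_]; last by rewrite !addn0.
  by rewrite ek0 muln0 muln1.
have Z : (\sum_(2 <= j < L) site (flip eta k) j =
   \sum_(2 <= j < L) site eta j + (2 <= k < L))%N.
  have -> : nat_of_bool (2 <= k < L)%N = (\sum_(2 <= j < L | j == k) 1)%N.
    by rewrite big_nat1_eq; case: ifP.
  rewrite [X in (_ + X)%N]big_mkcond -big_split /=.
  apply: eq_big_nat => j hj; rewrite !site_flip //; try lia.
  by case: eqP => [->|_]; rewrite ?ek0 ?addn0.
rewrite /ising_weight E Z !site_flip //; try lia.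
rewrite !exprD /fugacity.
case: (eqVneq k 1%N) => [k1|nk1].
  subst k; rewrite ek0 ifN; last by lia.
  rewrite expr0 expr1 /=; ring.
case: (eqVneq k L) => [kL|nkL].
  subst k; rewrite ek0 ltnn andbF expr0 expr1 /=.
  by ring.

have -> : (2 <= k < L)%N by lia.
by rewrite expr1; ring.
Qed.

(** [A] and [B] are the insertion and removal rates; they may depend on the
    other sites, which the flip leaves alone, so the flux is governed by the
    weight ratio [s] of the occupied and the empty state. *)
Lemma flip_balance eta k (w : config L -> R) (A B : R) :
  (1 <= k <= L)%N ->
  (forall xi, xi = eta \/ xi = flip eta k ->
     w xi = A * hole R xi k + B * occ R xi k) ->
  let s := fugacity k * y p ^+ left_nbr eta k * y p ^+ site eta k.+1 in
  W (flip eta k) * w (flip eta k) - W eta * w eta =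
  W eta * (if site eta k then A / s - B else B * s - A).
Proof.
move=> hk hw s.
have s0 : s != 0.
  by rewrite lt0r_neq0 // !mulr_gt0 ?exprn_gt0 ?y_gt0 ?fugacity_gt0.
rewrite !hw; [|by left|by right].
rewrite /hole /occ site_flip ?eqxx //; last by lia.
case ek : (site eta k) => /=; last first.
  by rewrite ising_weight_flip // -/s; ring.
have W2 := @ising_weight_flip (flip eta k) k hk.
rewrite flipK // in W2; rewrite W2.
  suff -> : fugacity k * y p ^+ left_nbr (flip eta k) k
      * y p ^+ site (flip eta k) k.+1 = s by field.
  rewrite /s /left_nbr (@site_flip _ eta k k.+1) //.
  have -> : (k.+1 == k) = false by lia.
  case: (ltnP 1 k) => //= k1; rewrite site_flip //; try lia.
  by rewrite ifN //; lia.
by rewrite site_flip ?eqxx ?ek //; lia.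
Qed.

(** Both configurations arise by inserting one particle into the configuration
    with sites k and k+1 empty, so the ratio follows from two flips. *)
Lemma ising_weight_exchange eta k : (1 <= k < L)%N ->
  site eta k = true -> site eta k.+1 = false ->
  W (exchange eta k) * (fugacity k * y p ^+ left_nbr eta k) =
  W eta * (fugacity k.+1 * y p ^+ site eta k.+2).
Proof.
move=> hk e1 e2.
rewrite exchange_flip ?e1 ?e2 //.
have hk' : (1 <= k <= L)%N by lia.
have hk1 : (1 <= k.+1 <= L)%N by lia.
have K1 : (k.+1 == k) = false by lia.
have K2 : (k.+2 == k) = false by lia.
have s0 : site (flip eta k) k = false by rewrite site_flip ?eqxx ?e1 //; lia.
have s1 : site (flip eta k) k.+1 = false by rewrite site_flip // K1.
rewrite (ising_weight_flip hk1 s1).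
have -> : left_nbr (flip eta k) k.+1 = false by rewrite /left_nbr /= s0 andbF.
rewrite site_flip // K2.
have := ising_weight_flip hk' s0.
rewrite flipK // s1 => ->.
have -> : left_nbr (flip eta k) k = left_nbr eta k.
  rewrite /left_nbr; case: (ltnP 1 k) => //= k1.
  rewrite site_flip //; try lia.
  by rewrite ifN //; lia.
by rewrite !expr0; ring.
Qed.

(** [A] and [B] are the rates of a jump to the right and to the left; they are
    functions of sites that the exchange leaves alone. *)
Lemma exchange_balance eta k (w : config L -> R) (A B : R) :
  (1 <= k < L)%N ->
  (forall xi, xi = eta \/ xi = exchange eta k ->
     w xi = A * (occ R xi k * hole R xi k.+1)
            + B * (hole R xi k * occ R xi k.+1)) ->
  let r := fugacity k.+1 * y p ^+ site eta k.+2
           / (fugacity k * y p ^+ left_nbr eta k) in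
  W (exchange eta k) * w (exchange eta k) - W eta * w eta =
  W eta * (if site eta k then if site eta k.+1 then 0 else B * r - A
           else if site eta k.+1 then A / r - B else 0).
Proof.
move=> hk hw r.
have yn0 n : y p ^+ n != 0 by rewrite lt0r_neq0 // exprn_gt0 ?y_gt0.
have fn0 j : fugacity j != 0 by rewrite lt0r_neq0 // fugacity_gt0.
case: (eqVneq (site eta k) (site eta k.+1)) => [e|ne].
  rewrite exchange_id // subrr -e.
  by case: (site eta k); rewrite mulr0.
rewrite !hw; [|by left|by right].
have K1 : (k.+1 == k) = false by lia.
rewrite /hole /occ !site_exchange ?eqxx ?K1 //; try lia.
case e1: (site eta k) ne; case e2: (site eta k.+1) => //= _.
  have -> : W (exchange eta k) = W eta * r.
    apply: (mulIf (mulf_neq0 (fn0 k) (yn0 (left_nbr eta k)))).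
    by rewrite ising_weight_exchange // /r; field; rewrite yn0 fn0.
  by ring.
have -> : W (exchange eta k) = W eta / r.
  have := @ising_weight_exchange (exchange eta k) k hk.
  rewrite exchangeK // !site_exchange ?eqxx ?K1 //; try lia.
  have -> : (k.+2 == k) = false by lia.
  have -> : (k.+2 == k.+1) = false by lia.
  have -> : left_nbr (exchange eta k) k = left_nbr eta k.
    rewrite /left_nbr; case: (ltnP 1 k) => //= k1.
    rewrite site_exchange //; try lia.
    by rewrite !ifN //; lia.
  move=> /(_ e2 e1) h.
  apply: (mulIf (mulf_neq0 (fn0 k.+1) (yn0 (site eta k.+2)))).
  by rewrite -h /r; field; rewrite !yn0 !fn0.
by ring.
Qed.

(** * Stationarity as vanishing flux *)

Definition net_flux (mu : config L -> R) eta : R :=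
  \sum_(1 <= k < L) (mu (exchange eta k) * bond_rate p (exchange eta k) k
                     - mu eta * bond_rate p eta k)
  + (mu (flip eta 1) * (alpha_rate p (flip eta 1) + gamma_rate p (flip eta 1))
     - mu eta * (alpha_rate p eta + gamma_rate p eta))
  + (mu (flip eta L) * (beta_rate p (flip eta L) + delta_rate p (flip eta L))
     - mu eta * (beta_rate p eta + delta_rate p eta)).

(** Moves of the dynamics are involutions of the configuration space, so the
    adjoint of a move is obtained by reindexing the sum along the move itself. *)
Lemma sum_involution (s : config L -> config L) (mu w g : config L -> R) :
  involutive s ->
  \sum_eta mu eta * (w eta * (g (s eta) - g eta)) =
  \sum_eta g eta * (mu (s eta) * w (s eta) - mu eta * w eta).
Proof.
move=> sK.
under eq_bigr do rewrite !mulrBr; rewrite sumrB.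
rewrite (reindex_inj (inv_inj sK)) /= -sumrB.
by apply: eq_bigr => eta _; rewrite sK; ring.
Qed.

Lemma sum_generator (mu g : config L -> R) :
  \sum_eta mu eta * generator p g eta = \sum_eta g eta * net_flux mu eta.
Proof.
have [h1 hLL] : (1 <= 1 <= L)%N /\ (1 <= L <= L)%N by lia.
rewrite /generator /net_flux.
under eq_bigr do rewrite 2!(mulrDr (mu _)) mulr_sumr.
under [RHS]eq_bigr do rewrite 2!(mulrDr (g _)) mulr_sumr.
rewrite !big_split /=; congr (_ + _ + _).
- rewrite exchange_big [RHS]exchange_big /=.
  apply: eq_big_nat => k hk.
  exact: (@sum_involution _ mu (fun eta => bond_rate p eta k) g (exchangeK hk)).
- exact: (@sum_involution _ mu (fun eta => alpha_rate p eta + gamma_rate p eta)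
            g (flipK h1)).
exact: (@sum_involution _ mu (fun eta => beta_rate p eta + delta_rate p eta)
          g (flipK hLL)).
Qed.

Lemma stationary_net_flux (mu : config L -> R) :
  (forall g, \sum_eta mu eta * generator p g eta = 0) <->
  (forall eta, net_flux mu eta = 0).
Proof.
split=> [h eta|h g].
  have := h (fun xi => (xi == eta)%:R); rewrite sum_generator.
  rewrite (bigD1 eta) //= eqxx mul1r big1 ?addr0 // => xi /negPf ->.
  by rewrite mul0r.
by rewrite sum_generator big1 // => eta _; rewrite h mulr0.
Qed.

(** * The flux of the Ising weight *)

(** The potential whose increments are the bulk fluxes per unit weight. It is
    symmetric under the reversal of its arguments, which makes the two ends
    mirror images of each other. *)
Definition bulk_current (b1 b2 b3 : bool) : R :=
  (f p + c p) * b2%:R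
  + (f p * eps p - c p) * (b1%:R * b2%:R + b2%:R * b3%:R)
  + (f p * eps p + c p) * (b1%:R * b3%:R)
  - 2 * (f p * eps p) * (b1%:R * b2%:R * b3%:R).

(** The flux per unit weight from the boundary bond (first summand), from the
    reservoir (second summand) and from the end term of the telescoping bulk
    sum. Sites are counted from the boundary inwards; at the right end the flux
    is minus this expression. *)
Definition edge_defect (s : side) (b1 b2 b3 : bool) : R :=
  (if b1 then
     if b2 then 0 else - (if b3 then d2 p s * (1 - eps p) else d1 p s)
   else
     if b2 then q p s * (if b3 then d2 p s * (1 + eps p) else d1 p s) else 0)
  + (if b1 then if b2 then a2 p s / y p else a1 p s
     else - (zb p s * if b2 then a2 p s else a1 p s))
  - bulk_current b1 b2 b3.

Let y_neq0 : y p != 0. Proof. by rewrite lt0r_neq0 ?y_gt0. Qed.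
Let z_neq0 : z p != 0. Proof. by rewrite lt0r_neq0 ?z_gt0. Qed.
Let zb_neq0 s : zb p s != 0. Proof. by rewrite lt0r_neq0 ?zb_gt0. Qed.
Let e1_neq0 : 1 + eps p != 0. Proof. by rewrite lt0r_neq0. Qed.
Let e2_neq0 : 1 - eps p != 0. Proof. by rewrite lt0r_neq0. Qed.

(** The gradient property: for each of the sixteen local patterns the difference
    of [bulk_current] matches gain minus loss. The sites k and k+1 have the same
    fugacity, so the weight ratio is a power of [y p] with exponent -1, 0 or 1,
    which the factors [1 - eps p] and [1 + eps p] of the rates absorb. *)
Lemma bulk_balance eta k : (2 <= k < L - 1)%N ->
  W (exchange eta k) * bond_rate p (exchange eta k) k
  - W eta * bond_rate p eta k =
  W eta * (bulk_current (site eta k) (site eta k.+1) (site eta k.+2)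
           - bulk_current (site eta k.-1) (site eta k) (site eta k.+1)).
Proof.
move=> hk; have hk' : (1 <= k < L)%N by lia.
rewrite (@exchange_balance eta k (fun xi => bond_rate p xi k)
  (hop_r p * ((1 + kappa p) * (hole R eta k.-1 - occ R eta k.+2)
     + (1 + eps p) * occ R eta k.-1 + (1 - eps p) * occ R eta k.+2))
  (hop_l p * ((1 + lambda p) * (hole R eta k.-1 - occ R eta k.+2)
     + (1 - eps p) * occ R eta k.-1 + (1 + eps p) * occ R eta k.+2))) //.
  congr (_ * _).
  have [f1 f2] : fugacity k = z p /\ fugacity k.+1 = z p.
    by rewrite /fugacity !ifN //; lia.
  rewrite f1 f2 /left_nbr; have -> : (1 < k)%N by lia.
  rewrite /bulk_current /hole /occ /f /c /y /=.
  by case: (site eta k.-1); case: (site eta k); case: (site eta k.+1);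
    case: (site eta k.+2) => /=; field; rewrite ?z_neq0 ?e1_neq0 ?e2_neq0.
move=> xi hxi.
have -> : hole R eta k.-1 = hole R xi k.-1.
  case: hxi => -> //; rewrite /hole /occ site_exchange //; try lia.
  by rewrite !ifN //; lia.
have -> : occ R eta k.-1 = occ R xi k.-1.
  case: hxi => -> //; rewrite /hole /occ site_exchange //; try lia.
  by rewrite !ifN //; lia.
have -> : occ R eta k.+2 = occ R xi k.+2.
  case: hxi => -> //; rewrite /hole /occ site_exchange //; try lia.
  by rewrite !ifN //; lia.
rewrite /bond_rate !ifN; try lia.
by rewrite /bulk_right /bulk_left; ring.
Qed.

Lemma left_edge_balance eta :
  W (exchange eta 1) * bond_rate p (exchange eta 1) 1
  - W eta * bond_rate p eta 1
  + (W (flip eta 1) * (alpha_rate p (flip eta 1) + gamma_rate p (flip eta 1))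
     - W eta * (alpha_rate p eta + gamma_rate p eta)) =
  W eta * (edge_defect Minus (site eta 1) (site eta 2) (site eta 3)
           + bulk_current (site eta 1) (site eta 2) (site eta 3)).
Proof.
have hk : (1 <= 1 < L)%N by lia.
have hk1 : (1 <= 1 <= L)%N by lia.
have L2 : (2 == L) = false by lia.
rewrite (@exchange_balance eta 1 (fun xi => bond_rate p xi 1)
  (rb1 p Minus * hole R eta 3 + rb2 p Minus * (1 - eps p) * occ R eta 3)
  (zb p Minus / z p *
    (lb1 p Minus * hole R eta 3 + lb2 p Minus * (1 + eps p) * occ R eta 3))) //.
  rewrite (@flip_balance eta 1
    (fun xi => alpha_rate p xi + gamma_rate p xi)
    (zb p Minus * (alpha1 p * hole R eta 2 + alpha2 p * occ R eta 2))
    (gamma1 p * hole R eta 2 + gamma2 p * occ R eta 2)) //.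
    rewrite -mulrDr; congr (_ * _).
    rewrite /edge_defect /fugacity L2 /left_nbr /hole /occ /= subrK.
    rewrite /q /d1 /d2 /a1 /a2 /y.
    by case: (site eta 1); case: (site eta 2); case: (site eta 3) => /=;
      field; rewrite ?z_neq0 ?zb_neq0 ?e1_neq0 ?e2_neq0.
  move=> xi hxi.
  have -> : hole R eta 2 = hole R xi 2.
    by case: hxi => -> //; rewrite /hole /occ site_flip.
  have -> : occ R eta 2 = occ R xi 2.
    by case: hxi => -> //; rewrite /hole /occ site_flip.
  by rewrite /alpha_rate /gamma_rate; ring.
move=> xi hxi.
have -> : hole R eta 3 = hole R xi 3.
  by case: hxi => -> //; rewrite /hole /occ site_exchange.
have -> : occ R eta 3 = occ R xi 3.
  by case: hxi => -> //; rewrite /hole /occ site_exchange.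
by rewrite /bond_rate /first_right /first_left /=; ring.
Qed.

Lemma right_edge_balance eta :
  W (exchange eta (L - 1)) * bond_rate p (exchange eta (L - 1)) (L - 1)
  - W eta * bond_rate p eta (L - 1)
  + (W (flip eta L) * (beta_rate p (flip eta L) + delta_rate p (flip eta L))
     - W eta * (beta_rate p eta + delta_rate p eta)) =
  - (W eta * (edge_defect Plus (site eta L) (site eta (L - 1)) (site eta (L - 2))
     + bulk_current (site eta (L - 2)) (site eta (L - 1)) (site eta L))).
Proof.
have hk : (1 <= L - 1 < L)%N by lia.
have hk1 : (1 <= L <= L)%N by lia.
have S1 : (L - 1).+1 = L by lia.
have P1 : (L - 1).-1 = (L - 2)%N by lia.
have P2 : L.-1 = (L - 1)%N by lia.
have N1 : (L - 1 == 1)%N = false by lia.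
have N2 : (L - 2 == L)%N = false by lia.
have N3 : (L - 2 == L - 1)%N = false by lia.
have N4 : (L - 1 == L)%N = false by lia.
have N5 : (L == 1)%N = false by lia.
have N6 : (1 < L - 1)%N by lia.
have N7 : (1 < L)%N by lia.
have N8 : (1 <= L - 2)%N by lia.
have N9 : (1 <= L - 1)%N by lia.
rewrite (@exchange_balance eta (L - 1) (fun xi => bond_rate p xi (L - 1))
  (zb p Plus / z p * (rb1 p Plus * hole R eta (L - 2)
     + rb2 p Plus * (1 + eps p) * occ R eta (L - 2)))
  (lb1 p Plus * hole R eta (L - 2)
     + lb2 p Plus * (1 - eps p) * occ R eta (L - 2))) //.
  rewrite (@flip_balance eta L
    (fun xi => beta_rate p xi + delta_rate p xi)
    (zb p Plus * (delta1 p * hole R eta (L - 1) + delta2 p * occ R eta (L - 1)))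
    (beta1 p * hole R eta (L - 1) + beta2 p * occ R eta (L - 1))) //.
    rewrite -mulrDr -[RHS]mulrN; congr (_ * _).
    rewrite /edge_defect /fugacity S1 N1 N4 N5 eqxx /left_nbr N6 N7 P1 P2.
    rewrite !(@site_over _ _ L.+1) // /hole /occ /bulk_current /=.
    rewrite /q /d1 /d2 /a1 /a2 /y.
    by case: (site eta (L - 2)); case: (site eta (L - 1));
      case: (site eta L) => /=;
      field; rewrite ?z_neq0 ?zb_neq0 ?e1_neq0 ?e2_neq0.
  move=> xi hxi.
  have -> : hole R eta (L - 1) = hole R xi (L - 1).
    by case: hxi => -> //; rewrite /hole /occ site_flip // N4.
  have -> : occ R eta (L - 1) = occ R xi (L - 1).
    by case: hxi => -> //; rewrite /hole /occ site_flip // N4.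
  by rewrite /beta_rate /delta_rate; ring.
move=> xi hxi.
have -> : hole R eta (L - 2) = hole R xi (L - 2).
  by case: hxi => -> //; rewrite /hole /occ site_exchange // S1 N2 N3.
have -> : occ R eta (L - 2) = occ R xi (L - 2).
  by case: hxi => -> //; rewrite /hole /occ site_exchange // S1 N2 N3.
by rewrite /bond_rate N1 eqxx S1 /last_right /last_left /=; ring.
Qed.

Lemma net_flux_ising eta : net_flux W eta =
  W eta * (edge_defect Minus (site eta 1) (site eta 2) (site eta 3)
           - edge_defect Plus (site eta L) (site eta (L - 1)) (site eta (L - 2))).
Proof.
have [S1 S2] : (L - 1).+1 = L /\ (L - 2).+1 = (L - 1)%N by lia.
rewrite /net_flux big_ltn; last by lia.
have -> : forall F : nat -> R, \sum_(2 <= k < L) F k =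
   \sum_(2 <= k < L - 1) F k + F (L - 1)%N.
  by move=> F; rewrite -{1}S1 big_nat_recr //=; lia.
have -> : \sum_(2 <= k < L - 1) (W (exchange eta k) *
     bond_rate p (exchange eta k) k - W eta * bond_rate p eta k) =
  W eta * (bulk_current (site eta (L - 2)) (site eta (L - 1)) (site eta L)
   - bulk_current (site eta 1) (site eta 2) (site eta 3)).
  under eq_big_nat do rewrite bulk_balance //.
  rewrite -mulr_sumr; congr (_ * _).
  rewrite (telescope_sumr_eq (fun k =>
    bulk_current (site eta k.-1) (site eta k) (site eta k.+1))) //; last by lia.
  by rewrite S1; have -> : (L - 1).-1 = (L - 2)%N by lia.
rewrite [LHS](_ : _ = (W (exchange eta 1) * bond_rate p (exchange eta 1) 1
  - W eta * bond_rate p eta 1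
  + (W (flip eta 1) * (alpha_rate p (flip eta 1) + gamma_rate p (flip eta 1))
     - W eta * (alpha_rate p eta + gamma_rate p eta))) +
  W eta * (bulk_current (site eta (L - 2)) (site eta (L - 1)) (site eta L)
   - bulk_current (site eta 1) (site eta 2) (site eta 3)) +
  (W (exchange eta (L - 1)) * bond_rate p (exchange eta (L - 1)) (L - 1)
  - W eta * bond_rate p eta (L - 1)
  + (W (flip eta L) * (beta_rate p (flip eta L) + delta_rate p (flip eta L))
     - W eta * (beta_rate p eta + delta_rate p eta)))); last by ring.
rewrite left_edge_balance right_edge_balance.
by ring.
Qed.

(** * Invariance as linear equations on the parameters *)

Lemma edge_defect_constant s :
  (forall b1 b2 b3, edge_defect s b1 b2 b3 = - (zb p s * a1 p s)) <->
  edge_equations (eps p) (f p) (c p) (q p s) (zb p s)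
    (d1 p s) (d2 p s) (a1 p s) (a2 p s).
Proof.
rewrite /edge_defect /bulk_current; split=> [H|[E1 E2 E3 E4 E5]].
  have /= H100 := H true false false; have /= H101 := H true false true.
  have /= H010 := H false true false; have /= H011 := H false true true.
  have /= H111 := H true true true.
  rewrite /y in H111.
  split; lra.
rewrite -/(y p) in E5.
by case; case; case => /=; lra.
Qed.

Definition stationarity_conditions : Prop :=
  (forall s, edge_equations (eps p) (f p) (c p) (q p s) (zb p s)
               (d1 p s) (d2 p s) (a1 p s) (a2 p s)) /\
  a1 p Plus * zb p Plus = a1 p Minus * zb p Minus.

(** The common constant on each side is read off on the empty triple, where a
    defect is [- (zb p s * a1 p s)]; equating the two constants gives the
    condition that links the two reservoirs. Any positive multiple of the
    weight is allowed, so that the product measures are covered too. *)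
Lemma proportional_invariant (mu : config L -> R) (C : R) :
  0 < C -> (forall eta, mu eta = C * W eta) -> is_probability mu ->
  invariant_measure p mu <-> stationarity_conditions.
Proof.
move=> C0 muE mu1.
have fluxE eta : net_flux mu eta = C * net_flux W eta.
  rewrite /net_flux !mulrDr mulr_sumr; congr (_ + _ + _).
  - by apply: eq_bigr => k _; rewrite !muE; ring.
  - by rewrite !muE; ring.
  by rewrite !muE; ring.
have cancelE eta : net_flux mu eta = 0 <->
    edge_defect Minus (site eta 1) (site eta 2) (site eta 3) =
    edge_defect Plus (site eta L) (site eta (L - 1)) (site eta (L - 2)).
  rewrite fluxE net_flux_ising mulrA; split=> [/eqP|->].
    rewrite mulf_eq0 subr_eq0 => /orP[|/eqP //].
    by rewrite gt_eqF // mulr_gt0 // ising_weight_gt0.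
  by rewrite subrr mulr0.
have d000 s : edge_defect s false false false = - (zb p s * a1 p s).
  by rewrite /edge_defect /bulk_current /=; ring.
split=> [[_ /stationary_net_flux h]|[h hC]].
  have h' eta := (cancelE eta).1 (h eta).
  have K s : edge_defect s false false false = edge_defect s false false true /\
             edge_defect s true true false = edge_defect s true true true.
    by rewrite /edge_defect /bulk_current /=; split; ring.
  have rigid := overlapping_ends hL (K Minus).1 (K Minus).2 (K Plus).1
                  (K Plus).2 h'.
  have hC : zb p Plus * a1 p Plus = zb p Minus * a1 p Minus.
    by apply: oppr_inj; rewrite -!d000; case: (rigid false false false).
  split; last by rewrite mulrC hC mulrC.
  move=> s; apply/edge_defect_constant => b1 b2 b3.
  by case: s; have [r1 r2] := rigid b1 b2 b3; rewrite ?r1 ?r2 d000 ?hC.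
split=> //; apply/stationary_net_flux => eta; apply/cancelE.
have D s := (edge_defect_constant s).2 (h s).
by rewrite !D mulrC -hC mulrC.
Qed.

Lemma ising_invariant :
  invariant_measure p (@ising_measure R p L) <-> stationarity_conditions.
Proof.
have Z0 : 0 < \sum_xi W xi.
  rewrite (bigD1 [tuple of nseq L false]) //= ltr_pwDl ?ising_weight_gt0 //.
  by apply: sumr_ge0 => xi _; rewrite ltW ?ising_weight_gt0.
apply: (@proportional_invariant _ (\sum_xi W xi)^-1).
- by rewrite invr_gt0.
- by move=> eta; rewrite mulrC.
split=> [eta|]; first by rewrite divr_ge0 ?ltW ?ising_weight_gt0.
by rewrite -mulr_suml divff ?lt0r_neq0.
Qed.

(** In this uniform form the total mass is a sum of products that factorizes. *)
Lemma bernoulli_measure_prod eta :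
  bernoulli_measure p eta =
  \prod_(i < L) (fugacity i.+1 ^+ tnth eta i / (1 + fugacity i.+1)).
Proof.
transitivity (\prod_(1 <= k < L.+1)
    (fugacity k ^+ site eta k / (1 + fugacity k))).
  rewrite big_ltn; last by lia.
  rewrite big_nat_recr /=; last by lia.
  rewrite /bernoulli_measure [RHS]mulrA.
  have -> : fugacity L = zb p Plus by rewrite /fugacity eqxx ifN //; lia.
  have -> : fugacity 1 = zb p Minus by rewrite /fugacity eqxx.
  congr (_ * _ * _); apply: eq_big_nat => k hk.
  by rewrite /fugacity !ifN //; lia.
rewrite big_add1 big_mkord /=; apply: eq_bigr => i _.
by rewrite (tnth_nth false).
Qed.

Lemma bernoulli_probability : is_probability (@bernoulli_measure R p L).
Proof.
have F0 k : 0 < 1 + fugacity k by rewrite addr_gt0 ?fugacity_gt0.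
split=> [eta|].
  rewrite bernoulli_measure_prod; apply: prodr_ge0 => i _.
  by rewrite divr_ge0 ?exprn_ge0 ?ltW ?fugacity_gt0.
under eq_bigr do rewrite bernoulli_measure_prod.
rewrite (reindex (fun g : {ffun 'I_L -> bool} => [tuple g i | i < L])) /=.
  under eq_bigr do under eq_bigr do rewrite tnth_mktuple.
  rewrite -(bigA_distr_bigA (fun (i : 'I_L) (b : bool) =>
    fugacity i.+1 ^+ b / (1 + fugacity i.+1))) big1 // => i _.
  rewrite big_bool /= expr1 expr0 -mulrDl addrC divff //.
  by rewrite lt0r_neq0.
apply: onW_bij; exists (fun t : L.-tuple bool => [ffun i => tnth t i]).
  by move=> g; apply/ffunP => i; rewrite ffunE tnth_mktuple.
by move=> t; apply: eq_from_tnth => i; rewrite tnth_mktuple ffunE.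
Qed.

Lemma bernoulli_ising_weight eta : eps p = 0 ->
  bernoulli_measure p eta =
  ((1 + zb p Minus)^-1 * \prod_(2 <= k < L) (1 + z p)^-1
   * (1 + zb p Plus)^-1) * W eta.
Proof.
move=> e0.
have y1 : y p = 1 by rewrite /y e0 subr0 addr0 divr1.
rewrite /bernoulli_measure /ising_weight y1 expr1n big_split /= prodrXr.
by ring.
Qed.

Lemma bernoulli_invariant : eps p = 0 ->
  invariant_measure p (@bernoulli_measure R p L) <-> stationarity_conditions.
Proof.
move=> e0; apply: (@proportional_invariant _ _ _
  (fun eta => bernoulli_ising_weight eta e0) bernoulli_probability).
rewrite !mulr_gt0 ?invr_gt0 ?addr_gt0 ?zb_gt0 //.
by apply: prodr_gt0 => k _; rewrite invr_gt0 addr_gt0 ?z_gt0.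
Qed.

End Balance.

Theorem theorem4p3 (R : realType) (L : nat) (p : kls_params R)
    (hL : (4 <= L)%N) (hp : admissible p) :
  (0 < `|eps p| < 1 ->
     (invariant_measure p (@ising_measure R p L) <->
      [/\ forall s : side,
            [/\ d1 p s = ((f p * eps p + c p) * (1 + eps p)
                          + (q p s)^-1 * (f p * eps p - c p) * (1 - eps p))
                         / (2 * eps p),
                d2 p s = ((f p * eps p + c p)
                          + (q p s)^-1 * (f p * eps p - c p)) / (2 * eps p),
                a1 p s = d1 p s / (1 + zb p s)
              & a2 p s = a1 p s
                         + (q p s - 1) * (((f p * eps p + c p) * (1 + eps p))
                                          / (2 * eps p * zb p s))],
          0 = 2 * eps p * a2 p Minus * (zb p Minus + (y p)^-1)
              - (q p Minus * (f p * eps p + c p) + (f p * eps p - c p))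
                * (1 + eps p)
          /\
          0 = 2 * eps p * a2 p Plus * (zb p Plus + (y p)^-1)
              - (q p Plus * (f p * eps p + c p) + (f p * eps p - c p))
                * (1 + eps p)
        & a1 p Plus * zb p Plus = a1 p Minus * zb p Minus]))
  /\
  (eps p = 0 -> c p <> 0 ->
     (invariant_measure p (@bernoulli_measure R p L) <->
      [/\ forall s : side,
            [/\ d1 p s = f p + c p / (1 + z p),
                d2 p s = f p - c p / (1 + (z p)^-1),
                a1 p s = d1 p s / (1 + z p)
              & a2 p s = a1 p s - c p / (1 + z p)],
          zb p Minus = z p /\ zb p Plus = z p
        & a1 p Plus = a1 p Minus]))
  /\
  (eps p = 0 -> c p = 0 ->
     (invariant_measure p (@bernoulli_measure R p L) <->
      (forall s : side,
         [/\ d1 p s = f p * ((1 + (zb p s)^-1) / (1 + (z p)^-1)),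
             d2 p s = f p * ((1 + (zb p s)^-1) / (1 + (z p)^-1)),
             a1 p s = f p * ((zb p s)^-1 / (1 + (z p)^-1))
           & a2 p s = f p * ((z p)^-1 / (1 + (z p)^-1))])
      /\ a1 p Plus * zb p Plus = a1 p Minus * zb p Minus)).
Proof.
have zp := z_gt0 hp; have zbp := zb_gt0 hp.
have /andP[eN e1] := eps_bound hp.
split=> [/andP[e0 _]|].
  have en0 : eps p != 0 by rewrite -normr_gt0.
  have equiv s := @edge_equations_ising R (eps p) (f p) (c p) (q p s) (zb p s)
    (d1 p s) (d2 p s) (a1 p s) (a2 p s) en0 ltac:(lra) ltac:(lra)
    (lt0r_neq0 (divr_gt0 (zbp s) zp)) (zbp s).
  rewrite (ising_invariant hL hp) /stationarity_conditions; split=> [[H hC]|[HA [HBm HBp] hC]].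
    have H' s := (equiv s).1 (H s).
    split=> [s||//]; first by have [] := H' s.
    by split; [have [] := H' Minus|have [] := H' Plus].
  by split=> // s; apply/equiv; split; [exact: HA|case: s].
split=> e0 hc; rewrite (bernoulli_invariant hL hp e0) /stationarity_conditions e0.
  have equiv s := @edge_equations_bernoulli_neq0 R (f p) (c p) (z p) (zb p s)
    (d1 p s) (d2 p s) (a1 p s) (a2 p s) ltac:(exact/eqP) zp (zbp s).
  split=> [[H hC]|[HA [zm zpl] hC]].
    have H' s := (equiv s).1 (H s).
    have [_ zm] := H' Minus; have [_ zpl] := H' Plus.
    split=> [s||]; [by have [] := H' s|by []|].
    by apply: (mulIf (lt0r_neq0 zp)); rewrite -{1}zpl -{1}zm.
  split=> [s|]; last by rewrite zm zpl hC.
  by apply/equiv; split; [exact: HA|case: s].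
rewrite hc; have equiv s := @edge_equations_bernoulli_eq0 R (f p) (z p) (zb p s)
  (d1 p s) (d2 p s) (a1 p s) (a2 p s) zp (zbp s).
by split=> -[H hC]; split=> // s; apply/equiv/H.
Qed.
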